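(* Let $G_2 := \bigoplus_{n=1}^{\infty} \mathbb{Z}/2\mathbb{Z}$. For all $\varepsilon>0$, there are sets $S,A\subseteq G_2$ such that $d^*(A)>1-\varepsilon$, every translate $S+g$ ($g\in G_2$) of $S$ is a set of topological recurrence, and $S+A$ is not piecewise syndetic.
   Context: Let $G$ be a countable abelian group. For $A,B\subseteq G$ and $g\in G$, $A+B=\{a+b:a\in A,b\in B\}$ and $A+g=\{a+g:a\in A\}$. A Følner sequence for $G$ is a sequence $\mathbf{\Phi}=(\Phi_n)_{n\in\mathbb{N}}$ of finite (nonempty) subsets of $G$ such that $\lim_{n\to\infty}\frac{|(\Phi_n+g)\cap\Phi_n|}{|\Phi_n|}=1$ for every $g\in G$. For $A\subseteq G$, $\bar d_{\mathbf{\Phi}}(A):=\limsup_{n\to\infty}\frac{|A\cap\Phi_n|}{|\Phi_n|}$, and the upper Banach density of $A$ is $d^*(A):=\sup\{\bar d_{\mathbf{\Phi}}(A):\mathbf{\Phi}\text{ is a Følner sequence for }G\}$. A set $S\subseteq G$ is syndetic if there is a finite set $F\subseteq G$ with $S+F=G$. A set $B\subseteq G$ is piecewise syndetic if there is a syndetic set $S\subseteq G$ such that for every finite $F\subseteq S$ there exists $g\in G$ with $F+g\subseteq B$. A topological $G$-system is a pair $(X,T)$ where $X$ is a (nonempty) compact metric space and $T$ is an action of $G$ on $X$ by homeomorphisms; it is minimal if for every $x\in X$ the orbit $\{T^gx : g\in G\}$ is dense in $X$. A set $S\subseteq G$ is a set of topological recurrence if for every minimal topological $G$-system $(X,T)$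 and every nonempty open $U\subseteq X$, there exists $g\in S$ such that $U\cap T^gU\neq\varnothing$. *)

(* Defs.v *)
From HB Require Import structures.
From mathcomp Require Import all_boot all_order all_algebra.
From mathcomp Require Import finmap.
From mathcomp Require Import all_classical all_reals all_analysis.

Set Implicit Arguments.
Unset Strict Implicit.
Unset Printing Implicit Defensive.

Import Order.TTheory GRing.Theory Num.Theory.
Import numFieldNormedType.Exports.

Local Open Scope classical_set_scope.
Local Open Scope ring_scope.

Definition sumset (G : zmodType) (A B : set G) : set G :=
  [set a + b | a in A & b in B].

Definition translate (G : zmodType) (A : set G) (g : G) : set G :=
  [set a + g | a in A].

(* [fset_set] sends infinite sets to the empty set; [proportion A F] is
   only used with [F] finite and nonempty. *)
Definition proportion (R : realType) (G : zmodType) (A F : set G) : R :=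
  #|` fset_set (A `&` F)|%:R / #|` fset_set F|%:R.

Definition folner (R : realType) (G : zmodType) (Phi : nat -> set G) : Prop :=
  (forall n, finite_set (Phi n) /\ Phi n !=set0) /\
  (forall g, proportion R (translate (Phi n) g) (Phi n) @[n --> \oo] --> (1 : R)).

Definition upper_density (R : realType) (G : zmodType) (Phi : nat -> set G)
    (A : set G) : \bar R :=
  limn_esup (fun n => (proportion R A (Phi n))%:E).

Definition upper_Banach_density (R : realType) (G : zmodType) (A : set G) :
    \bar R :=
  ereal_sup [set upper_density R Phi A | Phi in @folner R G].

Definition syndetic (G : zmodType) (S : set G) : Prop :=
  exists2 F : set G, finite_set F & sumset S F = setT.

Definition piecewise_syndetic (G : zmodType) (B : set G) : Prop :=
  exists2 S : set G, syndetic S &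
    forall F : set G, finite_set F -> F `<=` S ->
      exists g, translate F g `<=` B.

(* Each [T g] is a homeomorphism: its inverse is the continuous map [T (- g)]. *)
Definition continuous_action (G : zmodType) (X : topologicalType)
    (T : G -> X -> X) : Prop :=
  [/\ T 0 = id,
      forall g h, T (g + h) = T g \o T h
    & forall g, continuous (T g)].

Definition topological_system (R : realType) (G : zmodType) (X : metricType R)
    (T : G -> X -> X) : Prop :=
  [/\ [set: X] !=set0, compact [set: X] & continuous_action T].

Definition minimal_system (R : realType) (G : zmodType) (X : metricType R)
    (T : G -> X -> X) : Prop :=
  topological_system T /\ forall x, dense (range (fun g => T g x)).

Definition topological_recurrence (R : realType) (G : zmodType) (S : set G) :
    Prop :=
  forall (X : metricType R) (T : G -> X -> X), minimal_system T ->
  forall U : set X, open U -> U !=set0 ->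
    exists2 g, S g & U `&` T g @` U !=set0.

(* The direct sum of copies of Z/2Z indexed by [nat]: finitely supported
   functions with pointwise addition. *)
Definition finitely_supported : {pred nat -> 'Z_2} :=
  fun x => `[< finite_set [set n | x n != 0] >].

Fact finitely_supported_zmod_closed : zmod_closed finitely_supported.
Proof.
split=> [|x y /asboolP fx /asboolP fy]; apply/asboolP.
  by apply: (sub_finite_set _ (finite_set0 nat)) => n /=; exact/negP/negPn/eqP.
apply: (@sub_finite_set _ _ ([set n | x n != 0] `|` [set n | y n != 0])).
  move=> n /=; have [x0|] := eqVneq (x n) 0; last by left.
  have [y0|] := eqVneq (y n) 0; last by right.
  by rewrite /GRing.add /GRing.opp /= x0 y0 subrr eqxx.
by rewrite finite_setU.
Qed.

HB.instance Definition _ :=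
  GRing.isZmodClosed.Build (nat -> 'Z_2) finitely_supported
    finitely_supported_zmod_closed.

Record G2 : Type := MkG2 {
  G2_val :> nat -> 'Z_2;
  G2_valP : G2_val \in finitely_supported
}.

HB.instance Definition _ := [isSub for G2_val].
HB.instance Definition _ := [Choice of G2 by <:].
HB.instance Definition _ := [SubChoice_isSubZmodule of G2 by <:].

(* Main.v *)
(* The group is cut into consecutive blocks of coordinates, the block k having
   length 2 (n k) with n k growing fast, and g_0, g_1, ... lists every element
   of the group infinitely often, the support of g_k lying before block k.  A
   vector is heavy in block k if more than half of its coordinates there are 1.
   The map twist(y) = y + (sum of the g_k over the k where y is heavy) is
   triangular, hence a bijection.

   Let S consist of the vectors g_k + r where r is supported in block k and has
   all but at most 2k ones there, and let A be the image under twist of the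
   vectors whose weight in each block k differs from n k by more than 2k.  If y
   is such a vector, adding r flips its heaviness in block k, so that
   twist(y) + g_k + r = twist(y + r), and y + r does not have weight n k in
   any block k.  Thus S + A is contained in the twist of the vectors having no
   exactly balanced block, and as a bounded shift can balance a prescribed
   far block, this set is not piecewise syndetic.  Balanced blocks being
   rare, A has density close to 1.  Finally S + g_k contains all the sums of
   two nearly complementary vectors of block k, and by the Lovasz-Kneser
   theorem, proved here by counting modulo 2 the chains of signed sets whose
   signs alternate, every colouring with few colours gives the same colour
   to two such vectors: this is recurrence. *)
From HB Require Import structures.
From mathcomp Require Import all_boot all_order all_algebra all_fingroup zify.

Set Implicit Arguments.
Unset Strict Implicit.
Unset Printing Implicit Defensive.

(** * Alternating chains and Kneser colourings *)

(** A fixed-point-free involution splits [P] into pairs, and the two equal terms of each pair cancel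
    modulo 2; [enum_rank] picks one member of each. *)
Lemma addb_involution (T : finType) (f : T -> T) (P F : pred T) :
  involutive f -> (forall x, P x -> P (f x)) -> (forall x, P x -> f x != x) ->
  (forall x, P x -> F (f x) = F x) ->
  \big[addb/false]_(x | P x) F x = false.
Proof.
move=> fK Pf f_neq Ff.
have PfE x : P (f x) = P x by apply/idP/idP => /Pf //; rewrite fK.
pose lt x := (enum_rank x < enum_rank (f x))%N.
rewrite (bigID lt) /= [X in _ (+) X](reindex_inj (inv_inj fK)) /=.
rewrite [X in _ (+) X](eq_bigl (fun x => P x && lt x)); last first.
  move=> x; rewrite PfE; case Px: (P x) => //=.
  rewrite /lt fK -leqNgt leq_eqVlt; case: eqP => //= /val_inj/enum_rank_inj xfx.
  by have := f_neq _ Px; rewrite -xfx eqxx.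
rewrite [X in _ (+) X](eq_bigr F) ?addbb // => x /andP[Px _].
exact: Ff.
Qed.

Fixpoint alternates (b : bool) (l : seq bool) : bool :=
  if l is x :: l' then (x == b) && alternates (~~ b) l' else true.

Definition delete_nth (T : Type) (j : nat) (l : seq T) := take j l ++ drop j.+1 l.

Lemma alternates_map_negb b l :
  alternates b (map negb l) = alternates (~~ b) l.
Proof.
elim: l b => //= x l IH b; rewrite IH; congr (_ && _).
by case: x; case: b.
Qed.

(* The coboundary of the alternating cochain. *)
Lemma addb_alternates_delete_nth b l :
  \big[addb/false]_(j < size l) alternates b (delete_nth j l)
    = alternates b l (+) alternates (~~ b) l.
Proof.
elim: l b => [|x l IH] b /=; first by rewrite big_ord0.
rewrite big_ord_recl /= /delete_nth /= drop0.
have -> : \big[addb/false]_(j < size l) ((x == b) &&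
    alternates (~~ b) (take j l ++ drop j.+1 l))
    = (x == b) && (alternates (~~ b) l (+) alternates (~~ ~~ b) l).
  rewrite -IH; case: (x == b) => //=.
  by rewrite big1.
by rewrite negbK; case: x; case: b; rewrite /= ?addbb ?addbF //;
  case: (alternates true l); case: (alternates false l).
Qed.

Section AlternatingChain.
Variable N : nat.

(* A maximal chain of signed subsets of ['I_N] is encoded by the order [p.1] in
   which the elements are added and the set [p.2] of the elements that get
   the sign +. *)
Notation flag := ('S_N * {set 'I_N})%type.

Definition prefix_set (i : nat) (p : 'S_N) : {set 'I_N} :=
  [set x | ((p^-1)%g x < i)%N].

Definition pos_part (i : nat) (p : flag) := (prefix_set i p.1 :&: p.2).
Definition neg_part (i : nat) (p : flag) := (prefix_set i p.1 :\: p.2).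

Variable s : {set 'I_N} -> {set 'I_N} -> bool.
Hypothesis s_antipodal : forall P Q : {set 'I_N},
  [disjoint P & Q] -> (P :|: Q != set0) -> s Q P = ~~ s P Q.

Definition signs (d : nat) (p : flag) : seq bool :=
  [seq s (pos_part j.+1 p) (neg_part j.+1 p) | j <- iota 0 d].

(* The chains of the sphere spanned by the first [d] coordinates. *)
Definition in_sphere (d : nat) (p : flag) : bool :=
  [forall x : 'I_N, (d <= x)%N ==> (p.1 x == x) && (x \in p.2)].

(** The count of Ky Fan's combinatorial lemma, reduced modulo 2; it is shown to stay odd for every
    [d] up to [N]. *)
Definition parity (d : nat) : bool :=
  \big[addb/false]_(p : flag | in_sphere d p) alternates true (signs d p).

#[local] Arguments alternates b l : simpl never.

Lemma size_signs d p : size (signs d p) = d.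
Proof. by rewrite size_map size_iota. Qed.

Lemma in_sphereP d (p : flag) :
  reflect (forall x : 'I_N, (d <= x)%N -> p.1 x = x /\ x \in p.2) (in_sphere d p).
Proof.
apply: (iffP forallP) => [h x dx|h x].
  by have /implyP/(_ dx)/andP[/eqP] := h x.
by apply/implyP => /h[-> ->]; rewrite eqxx.
Qed.

Lemma parity0 : parity 0 = true.
Proof.
rewrite /parity (big_pred1 (1%g, [set: 'I_N])) // => -[p A] /=.
apply/in_sphereP/eqP => [h|[-> ->] x _]; last by rewrite perm1 inE.
congr (_, _); first by apply/permP => x; rewrite perm1; case: (h x).
by apply/setP => x; rewrite inE; case: (h x).
Qed.

Definition antipode (d : nat) (p : flag) : flag :=
  (p.1, [set x : 'I_N | if (x < d)%N then x \notin p.2 else x \in p.2]).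

Lemma antipodeK d : involutive (antipode d).
Proof.
case=> p A; rewrite /antipode /=; congr (_, _); apply/setP => x; rewrite !inE.
by case: (_ < _)%N; rewrite ?negbK.
Qed.

Lemma in_sphere_lt d i (p : flag) (x : 'I_N) : in_sphere d p -> (i <= d)%N ->
  x \in prefix_set i p.1 -> (x < d)%N.
Proof.
move=> /in_sphereP h id; rewrite inE => xi; rewrite ltnNge; apply/negP => dx.
have [px _] := h x dx; have := leq_trans xi id.
by rewrite -{1}px permK ltnNge dx.
Qed.

Lemma signs_antipode d (p : flag) : in_sphere d p -> (d <= N)%N ->
  signs d (antipode d p) = map negb (signs d p).
Proof.
move=> pd dN; rewrite /signs -map_comp; apply/eq_in_map => j.
rewrite mem_iota add0n => /andP[_ jd] /=.
have lt_d x : x \in prefix_set j.+1 p.1 -> (x < d)%N.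
  exact: in_sphere_lt.
have posE : pos_part j.+1 (antipode d p) = neg_part j.+1 p.
  apply/setP => x; have := lt_d x; rewrite !inE /=.
  by case: (_ < j.+1)%N => [/(_ isT) ->|]; rewrite ?andbT ?andbF.
have negE : neg_part j.+1 (antipode d p) = pos_part j.+1 p.
  apply/setP => x; have := lt_d x; rewrite !inE /=.
  by case: (_ < j.+1)%N => [/(_ isT) ->|]; rewrite ?negbK ?andbT ?andbF.
rewrite posE negE; apply: s_antipodal.
  rewrite -setI_eq0; apply/eqP/setP => x; rewrite !inE.
  by case: (x \in p.2); rewrite /= ?andbF.
apply/set0Pn; exists (p.1 (Ordinal (leq_trans jd dN))); rewrite !inE permK /=.
by rewrite ltnS leqnn; case: (_ \in _).
Qed.

Lemma prefix_set_tperm (a b : 'I_N) (i : nat) (p : 'S_N) :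
  val b = (val a).+1 -> i != val b ->
  prefix_set i (tperm a b * p)%g = prefix_set i p.
Proof.
move=> ba ib; apply/setP => x; rewrite !inE invMg tpermV permM.
by case: tpermP => [->|->|//]; move: ba ib => /=; case: ltngtP; lia.
Qed.

Lemma delete_nth_signs d j p q :
  (forall i, (i < d)%N -> i != j -> pos_part i.+1 p = pos_part i.+1 q
     /\ neg_part i.+1 p = neg_part i.+1 q) ->
  delete_nth j (signs d p) = delete_nth j (signs d q).
Proof.
move=> pq; rewrite /delete_nth /signs -!map_take -!map_drop.
congr (_ ++ _); apply/eq_in_map => i.
  rewrite take_iota mem_iota => /andP[_ ij].
  by have [||-> ->] := pq i; rewrite //; lia.
rewrite drop_iota mem_iota => /andP[ji id].
by have [||-> ->] := pq i; rewrite //; lia.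
Qed.

Lemma delete_nth_last d p : delete_nth d (signs d.+1 p) = signs d p.
Proof.
rewrite /delete_nth drop_oversize ?size_signs // cats0 /signs -map_take.
by rewrite take_iota; congr map; congr iota; lia.
Qed.

(** One hemisphere of the sphere on [d.+1] coordinates; its boundary is the sphere on the first
    [d]. *)
Definition upper (d : 'I_N) (p : flag) : bool :=
  in_sphere d.+1 p && (d \in p.2).

(** The antipode moves the chains of the other hemisphere into this one and negates their signs, so
    they are counted as alternating from [false]. *)
Lemma parity_upper (d : 'I_N) :
  parity d.+1 = \big[addb/false]_(p | upper d p)
    (alternates true (signs d.+1 p) (+) alternates false (signs d.+1 p)).
Proof.
have dN : (d < N)%N by [].
rewrite /parity (bigID (fun p : flag => d \in p.2)) /= big_split.
congr addb; rewrite (reindex_inj (inv_inj (antipodeK d.+1))) /=.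
have sphereE p : in_sphere d.+1 (antipode d.+1 p) = in_sphere d.+1 p.
  apply/in_sphereP/in_sphereP => h x dx; have [-> ] := h x dx;
  by rewrite !inE ltnNge dx.
rewrite (eq_bigl (upper d)); last first.
  by move=> p; rewrite sphereE !inE ltnSn negbK.
apply: eq_bigr => p /andP[pd _].
by rewrite signs_antipode // alternates_map_negb.
Qed.

(** A chain without its term [j] has exactly two completions, which differ by swapping the elements
    at positions [j] and [j.+1]; they cancel. *)
Lemma sum_delete_interior (d : 'I_N) (j : nat) : (j < d)%N ->
  \big[addb/false]_(p | upper d p)
    alternates true (delete_nth j (signs d.+1 p)) = false.
Proof.
move=> jd; pose a := Ordinal (ltn_trans jd (ltn_ord d)).
have bN : (j.+1 < N)%N by exact: leq_ltn_trans jd (ltn_ord d).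
pose b := Ordinal bN.
apply: (@addb_involution _ (fun p : flag => ((tperm a b * p.1)%g, p.2))).
- by case=> p A /=; rewrite mulgA tperm2 mul1g.
- move=> p /andP[/in_sphereP h dp]; apply/andP; split=> //.
  apply/in_sphereP => x dx; have [px xp] := h x dx; split=> //=.
  by rewrite permM tpermD // -val_eqE /= neq_ltn; lia.
- case=> p A _; apply/eqP => -[/(congr1 (fun q : 'S_N => q * p^-1)%g)].
  rewrite mulgK mulgV => /permP/(_ a); rewrite tpermL perm1.
  by move/(congr1 val) => /=; lia.
- move=> p _; congr alternates; apply: delete_nth_signs => i _ ij.
  by rewrite /pos_part /neg_part /= prefix_set_tperm //= eqSS.
Qed.

(** Without its top term the chain misses one element, [p.1 d]. If this is not [d], both of its
    signs are allowed and the two chains cancel; if it is [d], a chain of the equator remains. *)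
Lemma sum_delete_last (d : 'I_N) :
  \big[addb/false]_(p | upper d p)
    alternates true (delete_nth d (signs d.+1 p)) = parity d.
Proof.
rewrite (bigID (fun p : flag => p.1 d == d)) /=.
rewrite [X in _ (+) X](_ : _ = false) ?addbF.
  rewrite /parity; apply: eq_big => [p|p _]; last by rewrite delete_nth_last.
  apply/andP/in_sphereP => [[/andP[/in_sphereP h dp] /eqP pd] x|h].
    by rewrite leq_eqVlt => /predU1P[/val_inj <-|/h].
  split; last by have [-> _] := h d (leqnn d).
  apply/andP; split; last by have [] := h d (leqnn d).
  by apply/in_sphereP => x dx; apply: h; exact: ltnW.
pose flip (p : flag) : flag :=
  (p.1, [set x | (x \in p.2) (+) (x == p.1 d)]).
apply: (@addb_involution _ flip).
- by case=> p A; congr (_, _); apply/setP => x; rewrite !inE /= -addbA addbb addbF.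
- move=> p /andP[/andP[/in_sphereP h dp] pd] /=; rewrite pd andbT.
  apply/andP; split; last by rewrite inE dp eq_sym (negPf pd).
  apply/in_sphereP => x dx; have [px xp] := h x dx; split=> //=.
  rewrite inE xp /= -{1}px (inj_eq perm_inj); apply/eqP => xd.
  by rewrite xd ltnn in dx.
- case=> p A _; apply/eqP => -[/setP/(_ (p d))]; rewrite inE eqxx.
  by case: (_ \in _).
- move=> p _; rewrite !delete_nth_last; congr alternates.
  apply/eq_in_map => j; rewrite mem_iota add0n => /andP[_ jd].
  have pd x : x \in prefix_set j.+1 p.1 -> (x == p.1 d) = false.
    rewrite inE => xj; apply/eqP => xd; move: xj; rewrite xd permK; lia.
  congr s; apply/setP => x; have := pd x; rewrite !inE /=.
    by case: (_ < j.+1)%N => //= ->; rewrite ?addbF.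
  by case: (_ < j.+1)%N => [->|]; rewrite ?addbF ?andbF.
Qed.

(** A discrete Stokes formula: the coboundary identity turns the two alternation counts on the
    hemisphere into a sum over deleted terms, of which only the equator survives. *)
Lemma parityS (d : 'I_N) : parity d.+1 = parity d.
Proof.
rewrite parity_upper; under eq_bigr => p _.
  rewrite -[alternates false _]/(alternates (~~ true) _).
  rewrite -addb_alternates_delete_nth size_signs big_ord_recr /=; over.
rewrite big_split exchange_big /= sum_delete_last big1 // => j _.
exact: sum_delete_interior.
Qed.

Lemma alternating_chain : exists p : flag, alternates true (signs N p).
Proof.
have par d : (d <= N)%N -> parity d = true.
  by elim: d => [_|d IH dN]; rewrite ?parity0 // (parityS (Ordinal dN)) IH // ltnW.
have := par N (leqnn N); rewrite /parity.
have [p sp _|none] := pickP (fun p : flag => alternates true (signs N p)).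
  by exists p.
by rewrite big1.
Qed.

End AlternatingChain.

Lemma alternates_nth b l i : alternates b l -> (i.+1 < size l)%N ->
  nth false l i.+1 = ~~ nth false l i.
Proof.
elim: l b i => //= x l IH b [|i] /andP[/eqP -> al]; last exact: IH al.
by case: l al {IH} => //= y l /andP[/eqP ->].
Qed.

Lemma card_prefix_set N i (p : 'S_N) : (i <= N)%N -> #|prefix_set i p| = i.
Proof.
move=> iN; have -> : prefix_set i p = p @: [set x : 'I_N | (x < i)%N].
  apply/setP => x; rewrite inE; apply/idP/imsetP => [xi|[y yi ->]].
    by exists ((p^-1)%g x); rewrite ?inE ?permKV.
  by rewrite permK; rewrite inE in yi.
rewrite card_imset; last exact: perm_inj.
rewrite -sum1_card -[RHS]card_ord -sum1_card (big_ord_widen N (fun=> 1%N)) //.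
by apply: eq_bigl => x; rewrite inE.
Qed.

(* Matousek's argument: a signed set (P, Q) is coloured by the least colour of
   a set of size at least [m] inside P or Q, and its sign tells in which of the
   two that colour occurs.  Along an alternating chain the colour does not
   increase, so it is repeated by two consecutive terms. *)
Lemma kneser_coloring (N m q : nat) (c : {set 'I_N} -> nat) :
  (forall X, (c X < q)%N) -> (0 < m)%N -> (m.*2 + q <= N.+1)%N ->
  exists A B : {set 'I_N},
    [/\ [disjoint A & B], (m <= #|A|)%N, (m <= #|B|)%N & c A = c B].
Proof.
move=> cq m0 mqN.
pose has_color (P : {set 'I_N}) col :=
  [exists X : {set 'I_N}, [&& X \subset P, (m <= #|X|)%N & c X == col]].
pose least P := find (has_color P) (iota 0 q).
have leastP P : (least P < q)%N ->
    exists X : {set 'I_N}, [/\ X \subset P, (m <= #|X|)%N & c X = least P].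
  move=> Pq; have hasP : has (has_color P) (iota 0 q).
    by rewrite has_find size_iota.
  have := nth_find 0 hasP; rewrite -/(least P) nth_iota // add0n.
  by move=> /existsP[X /and3P[? ? /eqP ?]]; exists X.
have least_lt (P : {set 'I_N}) : (m <= #|P|)%N -> (least P < q)%N.
  move=> mP; rewrite -[X in (_ < X)%N](size_iota 0 q) -has_find.
  apply/hasP; exists (c P); first by rewrite mem_iota /=.
  by apply/existsP; exists P; rewrite subxx mP eqxx.
have least_mono (P P' : {set 'I_N}) : P \subset P' -> (least P' <= least P)%N.
  move=> PP'; apply: sub_find => col /existsP[X /and3P[XP mX cX]].
  by apply/existsP; exists X; rewrite (subset_trans XP) ?mX.
(* Ties are broken by rank, which makes [s] antipodal: disjoint sets that are not both empty are
   distinct. *)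
pose s P Q := (least P < least Q)%N
  || (least P == least Q) && (enum_rank P < enum_rank Q)%N.
have s_anti (P Q : {set 'I_N}) :
    [disjoint P & Q] -> P :|: Q != set0 -> s Q P = ~~ s P Q.
  move=> PQ0 PUQ; have PQ : P != Q.
    apply: contraNneq PUQ => PQ; rewrite PQ setUid -[Q]setIid -{1}PQ.
    by rewrite setI_eq0.
  have : enum_rank P != enum_rank Q :> nat.
    by rewrite val_eqE (inj_eq enum_rank_inj).
  by rewrite /s; case: (ltngtP (least P) (least Q)) => //= _; case: ltngtP.
have [p alt_p] := alternating_chain s_anti.
pose mu j := minn (least (pos_part j p)) (least (neg_part j p)).
have prefix_mono j : prefix_set j p.1 \subset prefix_set j.+1 p.1.
  by apply/subsetP => x; rewrite !inE => /leqW.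
have pos_mono j : pos_part j p \subset pos_part j.+1 p by exact: setSI.
have neg_mono j : neg_part j p \subset neg_part j.+1 p by exact: setSD.
have mu_mono j : (mu j.+1 <= mu j)%N.
  rewrite /mu leq_min !geq_min; apply/andP; split; apply/orP; [left|right];
    exact: least_mono.
(* A prefix of at least [m.*2.-1] elements has [m] elements of one sign, so it contains a coloured
   set; [least] is [q] when there is none. *)
have mu_lt j : (m.*2.-1 <= j <= N)%N -> (mu j < q)%N.
  move=> /andP[mj jN]; rewrite /mu gtn_min.
  have := cardsID p.2 (prefix_set j p.1).
  rewrite card_prefix_set // -/(pos_part j p) -/(neg_part j p) => sizes.
  by apply/orP; case: (leqP m #|pos_part j p|) => mp; [left|right];
    apply: least_lt => //; lia.
(* From [m.*2.-1] to [N] there are at least [q.+1] indices, too many for [mu] to decrease strictly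
   among values below [q]. *)
have [j [mj jN muj]] : exists j, [/\ (m.*2.-1 <= j)%N, (j < N)%N & mu j.+1 = mu j].
  have [/existsP[j /andP[mj /eqP muj]]|] :=
    boolP [exists j : 'I_N, (m.*2.-1 <= j)%N && (mu j.+1 == mu j)].
    by exists j; split.
  rewrite negb_exists => /forallP decr.
  suff : (mu N + (N - m.*2.-1) <= mu m.*2.-1)%N.
    by have := @mu_lt m.*2.-1; lia.
  have : (m.*2.-1 <= N)%N by lia.
  elim: {-2}N (leqnn N) => [|k IH] kN mk; first lia.
  move: mk; rewrite leq_eqVlt => /predU1P[->|mk]; first by rewrite subnn addn0.
  have := decr (Ordinal kN); have := mu_mono k; have := IH (ltnW kN) mk.
  by move=> {}IH mono /=; lia.
have signE i : (i < N)%N -> nth false (signs s N p) i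
    = s (pos_part i.+1 p) (neg_part i.+1 p).
  by move=> iN; rewrite (nth_map 0) ?size_iota // nth_iota.
have disj i (A B : {set 'I_N}) (sgn : bool) :
    A \subset (if sgn then pos_part i p else neg_part i p) ->
    B \subset (if sgn then neg_part i p else pos_part i p) -> [disjoint A & B].
  move=> Aj Bj; rewrite -setI_eq0 -subset0.
  apply: subset_trans (setISS Aj Bj) _; apply/subsetP => x.
  by case: sgn {Aj Bj}; rewrite !inE; case: (x \in p.2); rewrite ?andbF.
have j0 : (0 < j)%N by lia.
have := @alternates_nth _ _ j.-1 alt_p; rewrite size_signs prednK // => /(_ jN).
rewrite !signE ?prednK //; last lia.
have muq : (mu j < q)%N by apply: mu_lt; lia.
(* The signs at [j] and [j.+1] differ, so the common colour comes from opposite parts. Parts only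
   grow along the chain, hence the two sets are disjoint. *)
have finish (sgn : bool) :
    least (if sgn then pos_part j p else neg_part j p) = mu j ->
    least (if sgn then neg_part j.+1 p else pos_part j.+1 p) = mu j ->
    exists A B : {set 'I_N},
      [/\ [disjoint A & B], (m <= #|A|)%N, (m <= #|B|)%N & c A = c B].
  move=> lA lB; rewrite -lA in muq.
  have [A [Asub mA cA]] := leastP _ muq; rewrite lA -lB in muq.
  have [B [Bsub mB cB]] := leastP _ muq.
  exists A, B; split => //; last by rewrite cA cB lA lB.
  apply: (disj j.+1 A B sgn) => //; apply: subset_trans Asub _.
  by case: (sgn).
have sE P Q : least (if s P Q then P else Q) = minn (least P) (least Q).
  rewrite /s; case: (ltngtP (least P) (least Q)) => //= PQ.
  by case: ifP; rewrite ?PQ ?minnn.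
have := sE (pos_part j.+1 p) (neg_part j.+1 p).
have := sE (pos_part j p) (neg_part j p).
rewrite -/(mu j) -/(mu j.+1) muj => + + alt.
rewrite alt; case: (s _ _) => /=; [exact: finish true | exact: finish false].
Qed.

(** * Subsets meeting a set in about half of its elements *)

Lemma leq_bin_central n j : ('C(n.*2, j) <= 'C(n.*2, n))%N.
Proof.
have le_half d : (d <= n)%N -> ('C(n.*2, n - d) <= 'C(n.*2, n))%N.
  elim: d => [|d IH] dn; first by rewrite subn0.
  apply: leq_trans (IH (ltnW dn)).
  have := mul_bin_left n.*2 (n - d.+1); rewrite subnSK // => binE.
  rewrite -(@leq_pmul2l (n - d)) ?subn_gt0 // binE leq_mul2r; apply/orP; right; lia.
have [jn|nj] := leqP j n; first by rewrite -(subKn jn) le_half ?leq_subr.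
have [j2n|] := leqP j n.*2; last by move/bin_small ->.
rewrite -bin_sub // (_ : (n.*2 - j)%N = (n - (j - n))%N); last lia.
by apply: le_half; lia.
Qed.

(** Induction through [(n+1) C(2n+2, n+1) = 2(2n+1) C(2n, n)] and [(2n+1)(2n+3) <= 4(n+1)^2]. It
    says that [C(2n, n)] is at most [4^n / sqrt(2n+1)]. *)
Lemma bin_central_bound n : (n.*2.+1 * 'C(n.*2, n) ^ 2 <= 16 ^ n)%N.
Proof.
elim: n => // n IH.
have binE : (n.+1 * 'C(n.*2.+2, n.+1) = n.*2.+1.*2 * 'C(n.*2, n))%N.
  rewrite binS -(@bin_sub n.*2.+1 n); last lia.
  rewrite (_ : (n.*2.+1 - n = n.+1)%N); last lia.
  by rewrite addnn -muln2 mulnA -(mul_bin_diag n.*2.+1 n) /=; lia.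
rewrite doubleS -(@leq_pmul2l (n.+1 ^ 2)) ?expn_gt0 //.
rewrite mulnCA -expnMn binE expnMn.
have -> : (n.*2.+3 * (n.*2.+1.*2 ^ 2 * 'C(n.*2, n) ^ 2) =
  (4 * (n.*2.+3 * n.*2.+1)) * (n.*2.+1 * 'C(n.*2, n) ^ 2))%N by lia.
apply: (leq_trans (leq_mul (leqnn _) IH)).
rewrite (expnS 16) [leqRHS]mulnA leq_mul2r; apply/orP; right; lia.
Qed.

Lemma leq_card_bigcup (T I : finType) (P : pred I) (F : I -> {set T}) :
  (#|\bigcup_(i | P i) F i| <= \sum_(i | P i) #|F i|)%N.
Proof.
elim/big_ind2: _ => [|m A n B Am Bn|//]; first by rewrite cards0.
by rewrite (leq_trans (leq_card_setU A B)) // leq_add.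
Qed.

Lemma card_inter_eq (T : finType) (B : {set T}) j :
  (#|[set X : {set T} | #|X :&: B| == j]| <= 'C(#|B|, j) * 2 ^ (#|T| - #|B|))%N.
Proof.
have <- : #|~: B| = (#|T| - #|B|)%N by rewrite -(cardsC B) addKn.
rewrite -(cards_draws B) -(card_powerset (~: B)) -cardsX.
rewrite -(card_in_imset (f := fun X : {set T} => (X :&: B, X :\: B))).
  apply: subset_leq_card; apply/subsetP => _ /imsetP[X + ->].
  by rewrite !inE /= subsetIr => ->; rewrite setDE subsetIr.
by move=> X Y _ _ [XY XY']; rewrite -(setID X B) XY XY' setID.
Qed.

Lemma card_inter_near_half (T : finType) (B : {set T}) n t : #|B| = n.*2 ->
  (#|[set X : {set T} | n - t <= #|X :&: B| <= n + t]| * 4 ^ n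
     <= (t.*2.+1 * 'C(n.*2, n)) * 2 ^ #|T|)%N.
Proof.
move=> Bn; set near := [set X | _].
have nearE : near \subset
    \bigcup_(i < t.*2.+1) [set X : {set T} | #|X :&: B| == (n - t + i)%N].
  apply/subsetP => X; rewrite inE => /andP[lo hi].
  have iP : (#|X :&: B| - (n - t) < t.*2.+1)%N by lia.
  by apply/bigcupP; exists (Ordinal iP) => //; rewrite inE subnKC.
have nearB : (#|near| <= t.*2.+1 * ('C(n.*2, n) * 2 ^ (#|T| - n.*2)))%N.
  apply: leq_trans (subset_leq_card nearE) _.
  apply: leq_trans (leq_card_bigcup _ _) _.
  rewrite -[X in (_ <= X * _)%N]card_ord -sum_nat_const leq_sum // => i _.
  by rewrite (leq_trans (card_inter_eq _ _)) // Bn leq_mul2r leq_bin_central orbT.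
apply: leq_trans (leq_mul nearB (leqnn _)) _; rewrite -!mulnA leq_mul2l /=.
rewrite leq_mul2l; apply/orP; right.
by rewrite -[4%N]/(2 ^ 2)%N -expnM mul2n -expnD subnK // -Bn max_card.
Qed.

Lemma exists_bin_central_small t L : exists2 n, (t < n)%N &
  (L * 'C(n.*2, n) <= 4 ^ n)%N.
Proof.
exists (t.+1 + L ^ 2)%N; first by lia.
move: (t.+1 + L ^ 2)%N (leq_addl t.+1 (L ^ 2)) => n Ln.
rewrite -(@leq_exp2r _ _ 2) // expnMn -expnM (mulnC n) expnM.
apply: leq_trans (bin_central_bound n : _ <= (4 ^ 2) ^ n)%N; rewrite leq_mul2r; lia.
Qed.

Require Import Defs.
From mathcomp Require Import finmap.
From mathcomp Require Import all_classical all_reals all_analysis.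
Import Order.TTheory GRing.Theory Num.Theory.
Import numFieldNormedType.Exports.
Local Open Scope classical_set_scope.
Local Open Scope ring_scope.

(** * The group of finitely supported vectors *)

Lemma Z2E (u : 'Z_2) : u = (u != 0)%:R.
Proof. by case: u => [[|[|//]] lt_u]; apply/val_inj. Qed.

Lemma Z2_neq0D (u v : 'Z_2) : (u + v != 0) = (u != 0) (+) (v != 0).
Proof. by rewrite [u]Z2E [v]Z2E; case: (u != 0); case: (v != 0). Qed.

Lemma G2D (x y : G2) i : (x + y) i = x i + y i.
Proof. by []. Qed.

Lemma G20 i : (0 : G2) i = 0.
Proof. by []. Qed.

Lemma G2_eqP (x y : G2) : (forall i, x i = y i) -> x = y.
Proof. by move=> xy; apply/val_inj/funext. Qed.

Lemma G2_addxx (x : G2) : x + x = 0.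
Proof.
by apply: G2_eqP => i; rewrite G2D G20 [x i]Z2E; case: (_ != _); apply/val_inj.
Qed.

Lemma G2_oppr (x : G2) : - x = x.
Proof. by apply/eqP; rewrite eq_sym -addr_eq0 G2_addxx. Qed.

Lemma G2_sum (I : finType) (P : pred I) (F : I -> G2) i :
  (\sum_(j | P j) F j) i = \sum_(j | P j) F j i.
Proof. exact: (big_morph (fun x : G2 => x i) (fun x y => G2D x y i) (G20 i)). Qed.

Definition vanishes_from (M : nat) (x : G2) := forall i, (M <= i)%N -> x i = 0.

Lemma G2_bound (x : G2) : exists M, vanishes_from M x.
Proof.
have /asboolP xfin := G2_valP x; set A := [set i | _] in xfin.
exists (\max_(i <- fset_set A) i.+1)%N => i; apply: contraTeq => xi.
by rewrite -ltnNge; apply: leq_bigmax_seq; rewrite ?in_fset_set ?inE.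
Qed.

Fact indicator_finitely_supported (M : nat) (p : pred nat) :
  (fun i => ((i < M)%N && p i)%:R : 'Z_2) \in finitely_supported.
Proof.
apply/asboolP; apply: (sub_finite_set _ (finite_II M)) => i /=.
by case: (i < M)%N.
Qed.

Definition indicator M p : G2 := MkG2 (indicator_finitely_supported M p).

Lemma indicatorE M p i : indicator M p i = ((i < M)%N && p i)%:R.
Proof. by []. Qed.

Lemma indicator_neq0 M p i : (indicator M p i != 0) = (i < M)%N && p i.
Proof. by rewrite indicatorE; case: (_ && _). Qed.

Lemma indicator_from M p : vanishes_from M (indicator M p).
Proof. by move=> i Mi; rewrite indicatorE ltnNge Mi. Qed.

Lemma indicator_support M (x : G2) :
  vanishes_from M x -> indicator M (fun i => x i != 0) = x.
Proof.
move=> xM; apply: G2_eqP => i; rewrite indicatorE.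
by have [_|/xM ->] := ltnP i M; rewrite -?Z2E.
Qed.

Lemma vanishes_fromD M x y :
  vanishes_from M x -> vanishes_from M y -> vanishes_from M (x + y).
Proof. by move=> xM yM i Mi; rewrite G2D xM ?yM ?addr0. Qed.

Lemma vanishes_from_leq M M' x :
  (M <= M')%N -> vanishes_from M x -> vanishes_from M' x.
Proof. by move=> MM' xM i M'i; apply: xM; exact: leq_trans M'i. Qed.

Definition level M : set G2 := [set x | vanishes_from M x].

Definition embed (b N : nat) (X : {set 'I_N}) : G2 := indicator (b + N)
  (fun i => (b <= i)%N && if insub (i - b)%N is Some j then j \in X else false).

Lemma embed_neq0 b N (X : {set 'I_N}) (j : 'I_N) :
  (embed b X (b + j)%N != 0) = (j \in X).
Proof. by rewrite indicator_neq0 ltn_add2l ltn_ord leq_addr addKn valK. Qed.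

Lemma embed_out b N (X : {set 'I_N}) i : ~~ (b <= i < b + N)%N -> embed b X i = 0.
Proof.
rewrite indicatorE; case: (leqP b i) => [_ /= /negPf -> //|_ _].
by rewrite andbF.
Qed.

Lemma embed_inj N : injective (@embed 0 N).
Proof. by move=> X Y XY; apply/setP => j; rewrite -!(@embed_neq0 0) XY. Qed.

Lemma embed_level N (X : {set 'I_N}) : level N (embed 0 X).
Proof. exact: indicator_from. Qed.

Lemma level_embed N x : level N x -> exists X : {set 'I_N}, embed 0 X = x.
Proof.
move=> xN; exists [set j : 'I_N | x j != 0]%SET; apply: G2_eqP => i.
have [iN|Ni] := ltnP i N; last by rewrite xN // embed_level.
have := @embed_neq0 0 N [set j : 'I_N | x j != 0]%SET (Ordinal iN).
by rewrite inE /= add0n => xi; rewrite [LHS]Z2E xi -Z2E.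
Qed.

Lemma finite_level N : finite_set (level N).
Proof.
apply: (@sub_finite_set _ _ (@embed 0 N @` setT)).
  by move=> x /level_embed[X <-]; exists X.
exact/finite_image/finite_finset.
Qed.

Lemma finite_set_bound (F : set G2) : finite_set F -> exists M, F `<=` level M.
Proof.
move=> finF; pose bound x := projT1 (cid (G2_bound x)).
exists (\max_(x <- fset_set F) bound x)%N => x Fx i xi.
apply: (projT2 (cid (G2_bound x))); apply: leq_trans xi.
by apply: leq_bigmax_seq; rewrite ?in_fset_set ?inE.
Qed.

Lemma card_fset_set_geq (T : finType) (C : choiceType) (P : {set T}) (f : T -> C)
    (B : set C) : finite_set B -> injective f -> (forall x, x \in P -> B (f x)) ->
  (#|P| <= #|` fset_set B|)%N.
Proof.
move=> finB f_inj PB; rewrite cardE -(size_map f); apply: uniq_leq_size.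
  by rewrite map_inj_uniq ?enum_uniq.
move=> _ /mapP[x + ->]; rewrite mem_enum => xP.
by rewrite in_fset_set // inE; exact: PB.
Qed.

Lemma card_level N : #|` fset_set (level N)| = (2 ^ N)%N.
Proof.
have cardT : #|[set: {set 'I_N}]%SET| = (2 ^ N)%N.
  by rewrite -powersetT card_powerset cardsT card_ord.
apply/eqP; rewrite eqn_leq -{2}cardT (card_fset_set_geq _ (@embed_inj N)); last 2 first.
- exact: finite_level.
- by move=> X _; exact: embed_level.
rewrite andbT -cardT cardE -(size_map (@embed 0 N)); apply: uniq_leq_size.
  exact: fset_uniq.
move=> x; rewrite in_fset_set ?inE; last exact: finite_level.
move=> /level_embed[X <-]; apply: map_f.
by rewrite mem_enum inE.
Qed.

Lemma limn_esup_geq (R : realType) (u : nat -> \bar R) (c : \bar R) :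
  (forall i, (c <= u i)%E) -> (c <= limn_esup u)%E.
Proof.
move=> cu; apply: le_ereal_inf_tmp => _ [V V_oo <-].
have [i Vi] := filter_ex V_oo.
apply: le_trans (cu i) _; by apply: ereal_sup_ubound; exists i.
Qed.

Lemma sum_geometric_leq (f : nat -> nat) (B K : nat) :
  (forall k, f k * 2 ^ k.+1 <= B)%N -> (\sum_(k < K) f k <= B)%N.
Proof.
(* The induction keeps the remainder of the geometric series: the partial sum is at most
   [B (1 - 2^-K)]. *)
move=> fB; have : ((\sum_(k < K) f k) * 2 ^ K + B <= B * 2 ^ K)%N.
  elim: K => [|K IH]; first by rewrite big_ord0 expn0 !muln1.
  rewrite big_ord_recr /=; have := fB K; rewrite !expnS.
  by move: (2 ^ K)%N (\sum_(k < K) f k)%N (f K) IH => P s t; nia.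
have := expn_gt0 2 K; nia.
Qed.

(** * The twisted sets *)

Section Construction.
Variables (n : nat -> nat) (g : nat -> G2).

Definition block_start k := (\sum_(j < k) (n j).*2)%N.
Local Notation a := block_start.

Hypothesis n_large : forall k, (k.*2 < n k)%N.
Hypothesis g_below : forall k, vanishes_from (a k) (g k).

Definition weight k (x : G2) : nat := (\sum_(a k <= i < a k.+1) (x i != 0%R))%N.

Definition in_block k (x : G2) := forall i, ~~ (a k <= i < a k.+1)%N -> x i = 0.

Lemma block_startS k : a k.+1 = (a k + (n k).*2)%N.
Proof. by rewrite /block_start big_ord_recr. Qed.

Lemma block_start_leq : {homo a : k l / (k <= l)%N}.
Proof.
by apply: homo_leq => [k|k l m|k] //; [exact: leq_trans|rewrite block_startS leq_addr].
Qed.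

Lemma leq_block_start k : (k <= a k)%N.
Proof.
by elim: k => // k IH; rewrite block_startS; have := n_large k; lia.
Qed.

Definition heavy k (x : G2) := (n k < weight k x)%N.

Definition shift K (x : G2) : G2 := \sum_(k < K | heavy k x) g k.

(** Cutting the sum at [K] keeps it finite and gives the full twist on vectors vanishing from [a K],
    whose later blocks are not heavy. *)
Definition twist K (x : G2) : G2 := x + shift K x.

Lemma eq_weight k (x y : G2) :
  (forall i, (a k <= i)%N -> x i = y i) -> weight k x = weight k y.
Proof.
by move=> xy; apply: eq_big_nat => i /andP[ki _]; rewrite xy.
Qed.

Lemma weight0 k x : vanishes_from (a k) x -> weight k x = 0%N.
Proof.
by move=> xk; rewrite /weight big_nat big1 // => i /andP[/xk -> _]; rewrite eqxx.
Qed.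

Lemma twist_widen K L x : vanishes_from (a K) x -> (K <= L)%N ->
  twist L x = twist K x.
Proof.
move=> xK KL; congr (x + _).
rewrite /shift [RHS](big_ord_widen_cond _ (fun k => heavy k x) g KL).
rewrite big_mkcondr [LHS]big_mkcond [RHS]big_mkcond.
apply: eq_bigr => k _; case: ltnP => // Kk.
rewrite /heavy weight0 //; apply: vanishes_from_leq xK; exact: block_start_leq.
Qed.

Lemma twist_vanishes K x :
  vanishes_from (a K) x -> vanishes_from (a K) (twist K x).
Proof.
move=> xK; apply: vanishes_fromD => // i Ki; rewrite G2_sum big1 // => k _.
by apply: g_below; apply: leq_trans Ki; apply: block_start_leq; exact: ltnW.
Qed.

(* [g k] lives before block [k], so [twist] is triangular: the shift at a
   coordinate only depends on the later blocks. *)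
Lemma shift_agree K m (x y : G2) :
  (forall i, (a m.+1 <= i)%N -> x i = y i) ->
  forall i, (a m <= i)%N -> shift K x i = shift K y i.
Proof.
move=> xy i mi; rewrite /shift !G2_sum.
rewrite big_mkcond [RHS]big_mkcond; apply: eq_bigr => k _.
have [km|mk] := leqP k m.
  have -> : g k i = 0.
    by apply: g_below; apply: leq_trans mi; exact: block_start_leq.
  by rewrite !if_same.
rewrite /heavy (@eq_weight _ x y) // => j kj; apply: xy.
by apply: leq_trans kj; exact: block_start_leq.
Qed.

Lemma twist_agree K m (x y : G2) :
  (forall i, (a m <= i)%N -> x i = y i) ->
  forall i, (a m <= i)%N -> twist K x i = twist K y i.
Proof.
move=> xy i mi; rewrite /twist !G2D xy //; congr (_ + _).
apply: shift_agree mi => j mj; apply: xy.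
by apply: leq_trans mj; exact: block_start_leq.
Qed.

(** Injectivity, by descending over the blocks: where all later blocks agree, the shifts agree and
    cancel. *)
Lemma twist_agree_inv K m (x y : G2) :
  vanishes_from (a K) x -> vanishes_from (a K) y ->
  (forall i, (a m <= i)%N -> twist K x i = twist K y i) ->
  forall i, (a m <= i)%N -> x i = y i.
Proof.
move=> xK yK txy.
have [Km|/ltnW mK] := leqP K m.
  by move=> i mi; rewrite xK ?yK //; apply: leq_trans mi; exact: block_start_leq.
rewrite -(subKn mK) in txy *; elim: (K - m)%N (leq_subr m K) txy => [|d IH] dK txy.
  by rewrite subn0 => i Ki; rewrite xK ?yK.
have dE : (K - d.+1).+1 = (K - d)%N by lia.
have {}IH i : (a (K - d.+1).+1 <= i)%N -> x i = y i.
  rewrite dE; apply: IH => [|j dj]; first exact: ltnW.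
  by apply: txy; apply: leq_trans dj; apply: block_start_leq; lia.
move=> i di; have := txy i di.
rewrite /twist !G2D.
by rewrite (shift_agree K IH di); move/addIr.
Qed.

Lemma twist_surj K x : vanishes_from (a K) x ->
  exists2 y, vanishes_from (a K) y & twist K y = x.
Proof.
move=> xK.
have : forall d, (d <= K)%N -> exists2 y, vanishes_from (a K) y
    & forall i, (a (K - d) <= i)%N -> twist K y i = x i; last first.
  move=> /(_ K (leqnn K))[y yK yx]; exists y => //; apply: G2_eqP => i.
  by apply: yx; rewrite subnn /block_start big_ord0.
elim=> [_|d IH dK].
  by exists x => // i; rewrite subn0 => Ki; rewrite xK ?twist_vanishes.
have [y yK yx] := IH (ltnW dK).
have dE : (K - d.+1).+1 = (K - d)%N by lia.
(* [z] is the error left by [y] before block [K - d]. Adding it affects only the heaviness of blocks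
   [k < K - d], whose [g k] vanish at the coordinates being corrected. *)
pose z := indicator (a (K - d)) (fun i => (x - twist K y) i != 0).
have zE i : z i = if (i < a (K - d))%N then (x - twist K y) i else 0.
  by rewrite indicatorE; case: ifP => //= _; rewrite -Z2E.
exists (y + z).
  apply: vanishes_fromD => // i Ki; rewrite zE ltnNge.
  by rewrite (leq_trans _ Ki) // block_start_leq ?leq_subr.
move=> i di; rewrite /twist G2D.
rewrite (@shift_agree K (K - d.+1) (y + z) y) //; last first.
  by move=> j; rewrite dE => dj; rewrite G2D zE ltnNge dj addr0.
rewrite G2D zE -addrA [_ + shift K y i]addrC addrA -G2D -/(twist K y).
by case: ltnP => [_|/yx ->]; rewrite ?addr0 // -G2D addrC subrK.
Qed.

Lemma in_blockD_weight k j x r : in_block k r -> j != k ->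
  weight j (x + r) = weight j x.
Proof.
move=> rk jk; apply: eq_big_nat => i /andP[ji ij]; rewrite G2D rk ?addr0 //.
apply/negP => /andP[ki ik]; case: (ltngtP j k) jk => // [jk|kj] _.
  by have := leq_trans ij (block_start_leq jk); rewrite ltnNge ki.
by have := leq_trans ik (block_start_leq kj); rewrite ltnNge ji.
Qed.

Lemma weightD_geq k x r : (weight k r <= weight k (x + r)%R + weight k x)%N.
Proof.
rewrite /weight -big_split leq_sum // => i _; cbv beta; rewrite G2D Z2_neq0D.
by case: (x i != 0); case: (r i != 0).
Qed.

Lemma weightD_leq k x r :
  (weight k (x + r)%R + weight k x + weight k r <= (n k).*2.*2)%N.
Proof.
rewrite /weight -!big_split; cbv beta.
have -> : (n k).*2.*2 = (\sum_(a k <= i < a k.+1) 2)%N.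
  by rewrite sum_nat_const_nat block_startS addKn muln2.
rewrite leq_sum // => i _; rewrite G2D Z2_neq0D.
by case: (x i != 0); case: (r i != 0).
Qed.

Definition off_center k x :=
  (weight k x + k.*2 < n k)%N || (n k + k.*2 < weight k x)%N.

Definition almost_full k r := in_block k r /\ ((n k - k).*2 <= weight k r)%N.

(** Complementing the block reflects its weight about [n k], still more than [k.*2] away from it,
    and adding [r] differs from complementing in at most [k.*2] places. *)
Lemma heavyD k x r : off_center k x -> almost_full k r ->
  weight k (x + r) != n k /\ heavy k (x + r) = ~~ heavy k x.
Proof.
rewrite /off_center /heavy => kx [_ kr].
have := weightD_geq k x r; have := weightD_leq k x r.
by case/orP: kx; lia.
Qed.

(* Adding [r] flips the heaviness of block [k] and of no other block. *)
Lemma twistD K k (x r : G2) : (k < K)%N -> off_center k x -> almost_full k r ->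
  twist K (x + r) = twist K x + (g k + r).
Proof.
move=> kK kx kr; have [_ flip] := heavyD kx kr; have [rk _] := kr.
suff shiftE : shift K (x + r) = shift K x + g k.
  by rewrite /twist shiftE addrACA [r + g k]addrC.
pose k' := Ordinal kK; rewrite /shift [LHS]big_mkcond [in RHS]big_mkcond.
rewrite (bigD1 k') //= [in RHS](bigD1 k') //= flip addrAC; congr (_ + _).
  by case: (heavy k x); rewrite /= ?G2_addxx ?add0r.
apply: eq_bigr => j jk; rewrite /heavy (in_blockD_weight _ rk) //.
Qed.

(** * The two sets, and the failure of piecewise syndeticity of their sum *)

Definition recurrent_set : set G2 :=
  [set x | exists k r, almost_full k r /\ x = g k + r].

Definition dense_set : set G2 := [set x | exists K y,
  [/\ level (a K) y, forall k, off_center k y & x = twist K y]].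

Lemma in_block_level k r : in_block k r -> level (a k.+1) r.
Proof. by move=> rk i ki; apply: rk; rewrite [(i < _)%N]ltnNge ki andbF. Qed.

Lemma sumset_twist x : sumset recurrent_set dense_set x ->
  exists K y, [/\ level (a K) y, forall k, weight k y != n k & x = twist K y].
Proof.
move=> [_ [k [r [kr ->]]] [_ [K [y [yK off ->]]] <-]].
pose L := maxn K k.+1.
have KL : (a K <= a L)%N by apply: block_start_leq; exact: leq_maxl.
have kL : (a k.+1 <= a L)%N by apply: block_start_leq; exact: leq_maxr.
exists L, (y + r); split.
- apply: vanishes_fromD; first exact: vanishes_from_leq yK.
  by apply: vanishes_from_leq kL _; exact: in_block_level (proj1 kr).
- move=> j; have [->|jk] := eqVneq j k; first by have [] := heavyD (off k) kr.
  rewrite (in_blockD_weight _ (proj1 kr) jk); have := off j.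
  by rewrite /off_center; lia.
- rewrite (twistD (leq_maxr K k.+1) (off k) kr).
  by rewrite (twist_widen yK (leq_maxl _ _)) addrC.
Qed.

Lemma exists_center m L z : level (a L) z -> (m < L)%N -> exists z',
  [/\ level (a L) z', forall i, (a m.+1 <= i)%N -> z' i = z i & weight m z' = n m].
Proof.
move=> zL mL.
pose z' := indicator (a L) (fun i =>
  if (i < a m.+1)%N then (i < a m + n m)%N else z i != 0).
exists z'; split=> [|i mi|]; first exact: indicator_from.
  rewrite indicatorE [(i < a m.+1)%N]ltnNge mi /=.
  by rewrite -(indicatorE (a L) (fun i => z i != 0)) indicator_support.
have mLa : (a m.+1 <= a L)%N by exact: block_start_leq.
have z'E i : (i < a m.+1)%N -> (z' i != 0) = (i < a m + n m)%N.
  by move=> im; rewrite indicator_neq0 (leq_trans im) //= im.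
have tail0 : (\sum_(a m + n m <= i < a m.+1) (z' i != 0%R) = 0)%N.
  rewrite big_nat big1 // => i /andP[mi im].
  by rewrite z'E // ltnNge mi.
rewrite /weight (big_cat_nat (n := a m + n m)) ?leq_addr //; last first.
  by rewrite block_startS; lia.
rewrite tail0 Monoid.mulm1; transitivity (\sum_(a m <= i < a m + n m) 1)%N; last first.
  by rewrite sum_nat_const_nat addKn muln1.
by apply: eq_big_nat => i /andP[_ im]; rewrite z'E ?im // block_startS; lia.
Qed.

(** Thickness translates finitely many points by one [h]. One of them is such that, up to some [f]
    in [F], its translate is the twist of a vector balanced in block [m]. As [f] lives before block
    [m], untwisting the translate still gives a balanced block, against [sumset_twist]. *)
Lemma not_piecewise_syndetic : ~ piecewise_syndetic (sumset recurrent_set dense_set).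
Proof.
move=> [Y [F finF YF] thick].
have [m Fm] := finite_set_bound finF.
have /choice[yy yyP] v : exists y, Y y /\ exists2 f, F f & y + f = v.
  have : sumset Y F v by rewrite YF.
  by move=> [y Yy [f Ff yf]]; exists y; split=> //; exists f.
have [||h hY] := thick (yy @` level (a m.+1)).
- exact/finite_image/finite_level.
- by move=> _ [v _ <-]; exact: (proj1 (yyP v)).
have [M hM] := G2_bound h.
pose L := maxn M m.+1.
have hL : level (a L) h.
  apply: vanishes_from_leq hM; apply: leq_trans (leq_block_start _).
  exact: leq_maxl.
have [z zL zh] := twist_surj hL.
have [z' [z'L z'z z'm]] := exists_center zL (leq_maxr M m.+1).
(* [v + h] is the twist of [z']; [v] vanishes from [a m.+1] because [z'] agrees there with [z],
   whose twist is [h]. *)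
pose v := twist L z' + h.
have vm : level (a m.+1) v.
  by move=> i mi; rewrite G2D (twist_agree L z'z) // zh -G2D G2_addxx.
have [_ [f Ff yf]] := yyP v.
have [K [y' [y'K y'w yE]]] : exists K y, [/\ level (a K) y,
    forall k, weight k y != n k & yy v + h = twist K y].
  by apply: sumset_twist; apply: hY; exists (yy v) => //; exists v.
have yE' : twist K y' = twist L z' + f.
  rewrite -yE -[yy v](addrK f) yf G2_oppr /v addrAC -(addrA (twist L z')).
  by rewrite G2_addxx addr0.
have := y'w m; rewrite -z'm => /eqP; apply; apply: eq_weight.
pose L' := maxn K L.
have y'L' : level (a L') y'.
  by apply: vanishes_from_leq y'K; apply: block_start_leq; exact: leq_maxl.
have z'L' : level (a L') z'.
  by apply: vanishes_from_leq z'L; apply: block_start_leq; exact: leq_maxr.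
apply: (twist_agree_inv y'L' z'L') => i mi.
rewrite (twist_widen y'K) ?leq_maxl // (twist_widen z'L) ?leq_maxr // yE' G2D.
by rewrite (Fm _ Ff) ?addr0 //; apply: leq_trans mi; exact: leq_block_start.
Qed.

(** * Recurrence of the translates *)

Hypothesis g_dense : forall x q, exists2 k, (q <= k)%N & g k = x.

Lemma weightE k x : weight k x = #|[set j : 'I_(n k).*2 | x (a k + j)%N != 0]%SET|.
Proof.
rewrite /weight -{1}[a k]add0n big_addn block_startS addKn big_mkord -sum1_card.
rewrite [RHS]big_mkcond; apply: eq_bigr => j _; rewrite inE addnC.
by case: (_ != _).
Qed.

(** By compactness and minimality, every point is carried into [U] by some [h] in [level M]. A
    subset of block [k] is coloured by such an [h] for its image of [x0]; two large disjoint sets of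
    one colour give two points of [U] exchanged by [T r]. *)
Lemma recurrent_translate (R : realType) x :
  topological_recurrence R (translate recurrent_set x).
Proof.
move=> X T [[[x0 _] cX [T0 TD Tc]] Tdense] U oU U0.
have [M coverM] : exists M, forall p, exists2 h, level M h & U (T h p).
  have /compact_near_coveringP ncX := cX.
  have := ncX nat \oo (fun M p => exists2 h, level M h & U (T h p)).
  case=> [p _|M _ coverM]; last by exists M => p; apply: (coverM M) => /=.
  have [e [Ue [h _ he]]] := Tdense p U U0 oU; rewrite -{}he in Ue.
  have [M hM] := G2_bound h.
  exists (T h @^-1` U, [set M' | (M <= M')%N]).
    split; last exact: nbhs_infty_ge.
    exact: (Tc h p _ (open_nbhs_nbhs (conj oU Ue))).
  by move=> [q M'] [/= Uq MM']; exists h => //; exact: vanishes_from_leq hM.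
have cover v : {A : {set 'I_M} | U (T (embed 0 A) (T v x0))}.
  apply: cid; have [h hM Uh] := coverM (T v x0).
  by have [A Ah] := level_embed hM; exists A; rewrite Ah.
(* Taking [g k = x] puts [r] in the translate. With [q] colours, [q <= k] gives
   [2 (n k - k) + q <= 2 n k + 1], as [kneser_coloring] requires. *)
have [k qk gk] := g_dense x #|{set 'I_M}|.
pose color (A : {set 'I_(n k).*2}) : nat := enum_rank (projT1 (cover (embed (a k) A))).
have nk := n_large k.
have [|||A [B [AB mA mB cAB]]] := @kneser_coloring _ (n k - k) #|{set 'I_M}| color.
- by move=> A; exact: ltn_ord.
- by lia.
- by lia.
pose r := embed (a k) A + embed (a k) B.
have almost_r : almost_full k r.
  split=> [i ki|]; first by rewrite G2D !embed_out ?addr0 // -block_startS.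
  rewrite weightE -addnn (leq_trans (leq_add mA mB)) //.
  have /eqP <- : #|A :|: B|%SET == (#|A| + #|B|)%N by rewrite leq_card_setU.
  apply: subset_leq_card; apply/fintype.subsetP => j; rewrite !inE Z2_neq0D !embed_neq0.
  by case: (boolP (j \in A)) => // jA _; rewrite (disjointFr AB jA).
exists r; first by exists (g k + r); [exists k, r|rewrite gk addrAC G2_addxx add0r].
have h_eq : val (enum_rank (projT1 (cover (embed (a k) A)))) =
  val (enum_rank (projT1 (cover (embed (a k) B)))) by [].
move: (projT2 (cover (embed (a k) A))) (projT2 (cover (embed (a k) B))).
rewrite (enum_rank_inj (val_inj h_eq)); set h := embed 0 _ => UA UB.
exists (T h (T (embed (a k) B) x0)); split => //.
exists (T h (T (embed (a k) A) x0)) => //.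
have TDE u v p : T (u + v) p = T u (T v p) by rewrite TD.
by rewrite -!TDE -addrA addrCA /r addrAC G2_addxx add0r.
Qed.

(** * Density of the second set *)

Lemma weight_embed k M (X : {set 'I_M}) : (a k.+1 <= M)%N ->
  weight k (embed 0 X) = #|X :&: [set j : 'I_M | (a k <= j < a k.+1)%N]|%SET.
Proof.
move=> kM; rewrite /weight (big_nat_widen _ _ M) // (big_nat_widenl _ 0) // big_mkord.
rewrite -sum1_card [RHS]big_mkcond [LHS]big_mkcond; apply: eq_bigr => j _.
have := @embed_neq0 0 M X j; rewrite add0n => ->; rewrite !inE.
by rewrite andbC; case: (j \in X); rewrite /= ?if_same // andbC.
Qed.

Lemma card_block k M : (a k.+1 <= M)%N ->
  #|[set j : 'I_M | (a k <= j < a k.+1)%N]%SET| = (n k).*2.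
Proof.
move=> kM; rewrite -[RHS](addKn (a k)) -block_startS -[RHS]muln1.
rewrite -sum_nat_const_nat (big_nat_widen _ _ M) // (big_nat_widenl _ 0) //.
rewrite big_mkord -sum1_card; apply: eq_bigl => j.
by rewrite inE andbC.
Qed.

Variable c : nat.
(** Makes the proportion of vectors not off center in block [k] at most [1 / (c 2^(k+1))]; the
    factor [k.*2.*2.+1] counts the weights within [k.*2] of [n k]. *)
Hypothesis n_sparse : forall k,
  (c * 2 ^ k.+1 * (k.*2.*2.+1 * 'C((n k).*2, n k)) <= 4 ^ n k)%N.

Definition central K : {set {set 'I_(a K)}} :=
  (\bigcup_(k < K) [set X | ~~ off_center k (embed 0 X)])%SET.

Lemma card_central K : (c * #|central K| <= 2 ^ a K)%N.
Proof.
pose near k := [set X : {set 'I_(a K)} | ~~ off_center k (embed 0 X)]%SET.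
apply: leq_trans (leq_mul (leqnn c) (leq_card_bigcup _ _)) _.
rewrite big_distrr /=.
pose f k := if (k < K)%N then (c * #|near k|)%N else 0%N.
rewrite (eq_bigr (fun k : 'I_K => f k)); last by move=> k _; rewrite /f ltn_ord.
apply: sum_geometric_leq => k; rewrite /f; case: ltnP => // kK.
have kM : (a k.+1 <= a K)%N by exact: block_start_leq.
have := card_inter_near_half k.*2 (card_block kM).
set near' := [set X | _]%SET; rewrite card_ord.
have -> : near' = near k.
  apply/setP => X; rewrite !inE /off_center weight_embed // negb_or -!leqNgt.
  by rewrite leq_subLR [(k.*2 + _)%N]addnC.
move=> near_le; rewrite -(@leq_pmul2r (4 ^ n k)) ?expn_gt0 // [leqRHS]mulnC.
apply: leq_trans (leq_mul (n_sparse k) (leqnn _)).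
rewrite [(c * #|near k| * _)%N]mulnAC -[leqLHS]mulnA -[leqRHS]mulnA.
by rewrite leq_mul2l near_le orbT.
Qed.

(** The sets outside [central K] are sent injectively by [twist K] after [embed 0] into the part of
    [dense_set] lying in [level (a K)]. *)
Lemma proportion_dense_set (R : realType) K : (0 < c)%N ->
  1 - c%:R^-1 <= proportion R dense_set (level (a K)).
Proof.
move=> c0; rewrite /proportion card_level.
have finA : finite_set (dense_set `&` level (a K)).
  by apply: sub_finite_set (finite_level (a K)) => x [].
have geq : (2 ^ a K - #|central K| <= #|` fset_set (dense_set `&` level (a K))|)%N.
  have <- : #|~: central K|%SET = (2 ^ a K - #|central K|)%N.
    by rewrite cardsCs finset.setCK -cardsT -powersetT card_powerset cardsT card_ord.
  apply: (@card_fset_set_geq _ _ _ (fun X => twist K (embed 0 X))) => //.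
    move=> X Y XY; apply: embed_inj; apply: G2_eqP => i.
    apply: (@twist_agree_inv K 0) => //; try exact: embed_level.
      by move=> j _; rewrite XY.
    by rewrite /block_start big_ord0.
  move=> X; rewrite inE => Xoff; split; last first.
    by apply: twist_vanishes; exact: embed_level.
  exists K, (embed 0 X); split=> // [|k]; first exact: embed_level.
  have [kK|Kk] := ltnP k K.
    apply: contraNT Xoff => Xk; apply/bigcupP; exists (Ordinal kK) => //.
    by rewrite inE.
  (* From block [K] on the weight is 0, which is off center since [k.*2 < n k]. *)
  rewrite /off_center weight0 ?add0n ?n_large //.
  apply: vanishes_from_leq (embed_level X); exact: block_start_leq.
rewrite ler_pdivlMr ?ltr0n ?expn_gt0 // mulrBl mul1r lerBlDl.
apply: (@le_trans _ _ (#|central K|%:R + (2 ^ a K - #|central K|)%N%:R)).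
  by rewrite -natrD ler_nat; lia.
apply: lerD; last by rewrite ler_nat.
by rewrite ler_pdivlMl ?ltr0n // -natrM ler_nat card_central.
Qed.

(** These finite subgroups exhaust the group, so each [x] eventually lies in them and the proportion
    is then exactly 1. *)
Lemma folner_level (R : realType) : folner R (fun K => level (a K)).
Proof.
split=> [K|x]; first by split; [exact: finite_level|exists 0].
apply: cvg_near_cst; have [M xM] := G2_bound x.
exists M => // K MK; rewrite /proportion.
have -> : translate (level (a K)) x = level (a K).
  have xK : level (a K) x.
    by apply: vanishes_from_leq xM; exact: leq_trans (leq_block_start K).
  apply/seteqP; split=> [_ [y yK <-]|y yK]; first exact: vanishes_fromD.
  exists (y + x); first exact: vanishes_fromD.
  by rewrite -addrA G2_addxx addr0.
by rewrite setIid divff // pnatr_eq0 card_level -lt0n expn_gt0.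
Qed.

Lemma upper_Banach_density_geq (R : realType) : (0 < c)%N ->
  ((1 - c%:R^-1)%:E <= upper_Banach_density R dense_set)%E.
Proof.
move=> c0; apply: le_trans (ereal_sup_ubound _); last first.
  by exists (fun K => level (a K)); first exact: folner_level.
by apply: limn_esup_geq => K; rewrite lee_fin proportion_dense_set.
Qed.

End Construction.

(** * Choice of the block lengths and of the enumeration *)

Theorem theorem1p6 (R : realType) (eps : R) (eps_gt0 : 0 < eps) :
  exists S A : set G2,
    [/\ ((1 - eps)%:E < upper_Banach_density R A)%E,
        forall g : G2, topological_recurrence R (translate S g)
      & ~ piecewise_syndetic (sumset S A)].
Proof.
have [c c_gt0 c_eps] : exists2 c, (0 < c)%N & c%:R^-1 < eps.
  exists (Num.truncn eps^-1).+1 => //.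
  by rewrite invf_plt ?posrE ?ltr0n // truncnS_gt.
have sizeP k : exists m, (k.*2 < m)%N /\
    (c * 2 ^ k.+1 * (k.*2.*2.+1 * 'C(m.*2, m)) <= 4 ^ m)%N.
  have [m km mk] := exists_bin_central_small k.*2 (c * 2 ^ k.+1 * k.*2.*2.+1).
  by exists m; rewrite km mulnA.
have [n nP] := choice sizeP.
have n_large k : (k.*2 < n k)%N by have [] := nP k.
pose g k := indicator (block_start n k)
  (fun i => i \in CodeSeq.decode (logn 2 k)).
have g_below k : vanishes_from (block_start n k) (g k) by exact: indicator_from.
(* The 2-adic valuation takes every value infinitely often. *)
have g_dense x q : exists2 k, (q <= k)%N & g k = x.
  have [M xM] := G2_bound x.
  pose s := [seq i <- iota 0 M | x i != 0].
  (* The odd factor leaves the valuation unchanged and makes [k] at least [q + M], so that the cut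
     at the start of block [k] keeps the whole support of [x]. *)
  pose k := (2 ^ CodeSeq.code s * (q + M).*2.+1)%N.
  have qk : (q + M <= k)%N.
    rewrite /k -[X in (X <= _)%N]mul1n leq_mul ?expn_gt0 //; lia.
  exists k; first by rewrite (leq_trans _ qk) ?leq_addr.
  have sE : CodeSeq.decode (logn 2 k) = s.
    rewrite lognM ?expn_gt0 // pfactorK // [logn 2 _.*2.+1]lognE /=.
    by rewrite dvdn2 /= odd_double addn0 CodeSeq.codeK.
  have Mk : (M <= block_start n k)%N.
    apply: leq_trans (leq_block_start n_large k).
    by rewrite (leq_trans _ qk) ?leq_addl.
  rewrite -[RHS](indicator_support (vanishes_from_leq Mk xM)).
  apply: G2_eqP => i; rewrite !indicatorE sE mem_filter mem_iota.
  by case: (leqP M i) => [/xM ->|]; rewrite ?eqxx ?andbF ?andbT.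
exists (recurrent_set n g), (dense_set n g); split.
- have n_sparse k := proj2 (nP k).
  apply: lt_le_trans (upper_Banach_density_geq n_large g_below n_sparse R c_gt0).
  by rewrite lte_fin ltrD2l ltrN2.
- exact: recurrent_translate.
- exact: not_piecewise_syndetic.
Qed.
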